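(* Let $\mathcal{M}$ be a concurrent game model, $q_{in}$ a state of $\mathcal{M}$ and $\varphi$ an ATL-formula. Then $\mathcal{M},q_{in}\models\varphi$ if and only if $\mathcal{M},q_{in}\models^g_u\varphi$.
   Context: A concurrent game model (CGM) is $\mathcal{M}=(\mathrm{Agt},\mathrm{St},\Pi,\mathrm{Act},d,o,v)$: $\mathrm{Agt}=\{1,\dots,k\}$ agents; nonempty sets $\mathrm{St}$ (states), $\Pi$ (proposition symbols), $\mathrm{Act}$ (actions); $d:\mathrm{Agt}\times\mathrm{St}\to\mathcal{P}(\mathrm{Act})\setminus\{\emptyset\}$; $o$ assigns to each state $q$ and each action profile $\vec\alpha=(\alpha_1,\dots,\alpha_k)$ with $\alpha_i\in d(i,q)$ an outcome state $o(q,\vec\alpha)$; $v:\Pi\to\mathcal{P}(\mathrm{St})$. For $A\subseteq\mathrm{Agt}$, $\overline{A}=\mathrm{Agt}\setminus A$ and $\mathrm{action}(A,q)$ is the set of tuples $(\alpha_i)_{i\in A}$ with $\alpha_i\in d(i,q)$. A (positional) strategy for agent $a$ is $s_a:\mathrm{St}\to\mathrm{Act}$ with $s_a(q)\in d(a,q)$; a collective strategy $S_A$ is a tuple of strategies, one for each $a\in A$; $\mathrm{paths}(q,S_A)$ is the set of infinite sequences $\Lambda$ of states with $\Lambda[0]=q$ and $\Lambda[n+1]=o(\Lambda[n],\vec\alpha)$ for some action profile $\vec\alpha$ at $\Lambda[n]$ in which every $a\in A$ plays $s_a(\Lambda[n])$. ATL formulae: $\varphi::=p\mid\neg\varphi\mid(\varphi\vee\varphi)\mid\langle\!\langle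 A\rangle\!\rangle\mathsf{X}\varphi\mid\langle\!\langle A\rangle\!\rangle\varphi\,\mathsf{U}\,\varphi\mid\langle\!\langle A\rangle\!\rangle\varphi\,\mathsf{R}\,\varphi$. Standard semantics $\models$: $q\models p$ iff $q\in v(p)$; Boolean clauses as usual; $q\models\langle\!\langle A\rangle\!\rangle\mathsf{X}\psi$ iff some $S_A$ has $\Lambda[1]\models\psi$ for all $\Lambda\in\mathrm{paths}(q,S_A)$; $q\models\langle\!\langle A\rangle\!\rangle\psi\mathsf{U}\theta$ iff some $S_A$ is such that for every $\Lambda\in\mathrm{paths}(q,S_A)$ there is $i\geq0$ with $\Lambda[i]\models\theta$ and $\Lambda[j]\models\psi$ for all $j<i$; $q\models\langle\!\langle A\rangle\!\rangle\psi\mathsf{R}\theta$ iff some $S_A$ is such that for every $\Lambda\in\mathrm{paths}(q,S_A)$ and $i\geq0$, $\Lambda[i]\models\theta$ or $\Lambda[j]\models\psi$ for some $j<i$. Players: Eloise $\mathbf{E}$, Abelard $\mathbf{A}$; $\overline{\mathbf{P}}$ is the opponent of $\mathbf{P}$. One step game $\mathrm{step}(\mathbf{P},A,q)$: $\mathbf{P}$ picks a tuple in $\mathrm{action}(A,q)$, then $\overline{\mathbf{P}}$ picks a tuple in $\mathrm{action}(\overline{A},q)$; the resulting state is the outcome of the combined profile. Unbounded evaluation game $\mathcal{G}(\mathcal{M},q_{in},\varphi)$: positions $(\mathbf{P},q,\psi)$ with $\psi$ a subformula of $\varphi$; start $(\mathbf{E},q_{in},\varphi)$. At $(\mathbf{P},q,p)$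 the game ends, $\mathbf{P}$ wins iff $q\in v(p)$, else $\overline{\mathbf{P}}$ wins. $(\mathbf{P},q,\neg\psi)\to(\overline{\mathbf{P}},q,\psi)$. At $(\mathbf{P},q,\psi\vee\theta)$, $\mathbf{P}$ chooses $(\mathbf{P},q,\psi)$ or $(\mathbf{P},q,\theta)$. At $(\mathbf{P},q,\langle\!\langle A\rangle\!\rangle\mathsf{X}\psi)$, $\mathrm{step}(\mathbf{P},A,q)$ gives $q'$, next $(\mathbf{P},q',\psi)$. At $(\mathbf{P},q,\langle\!\langle A\rangle\!\rangle\psi\mathsf{U}\theta)$ the embedded game $\mathbf{g}(\mathbf{P},\mathbf{P},A,q,\theta,\psi)$ is played; at $(\mathbf{P},q,\langle\!\langle A\rangle\!\rangle\psi\mathsf{R}\theta)$ the embedded game $\mathbf{g}(\mathbf{P},\overline{\mathbf{P}},A,q,\theta,\psi)$. An embedded game $\mathbf{g}(\mathbf{V},\mathbf{C},A,q_0,\psi_{\mathbf{C}},\psi_{\overline{\mathbf{C}}})$ (verifier $\mathbf{V}$, controller $\mathbf{C}$) proceeds from $q_0$; at current state $q$: (i) $\mathbf{C}$ may end it at exit position $(\mathbf{V},q,\psi_{\mathbf{C}})$; (ii) $\overline{\mathbf{C}}$ may end it at $(\mathbf{V},q,\psi_{\overline{\mathbf{C}}})$; (iii) otherwise $\mathrm{step}(\mathbf{V},A,q)$ gives $q'$ and play continues from $q'$. If it lasts infinitely many rounds, $\mathbf{C}$ loses the evaluation game; otherwise the evaluation game continues from the exit position. A strategy for a player specifies disjunct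 choices, tuples of actions (as verifier) or response functions $\mathrm{action}(A,q)\to\mathrm{action}(\overline{A},q)$ (as falsifier) in one step games, and for each until/release position an embedded-game strategy depending only on the current state (at each state: ''end the game'' as permitted by the player's role, or an action tuple / response function). $\mathcal{M},q\models^g_u\varphi$ iff $\mathbf{E}$ has a strategy in $\mathcal{G}(\mathcal{M},q,\varphi)$ winning all plays consistent with it. *)

(* Defs.v *)
From mathcomp Require Import all_boot.

Set Implicit Arguments.
Unset Strict Implicit.
Unset Printing Implicit Defensive.

(* Agents are numbered 0, ..., k-1.  The outcome function is defined exactly on
   the action profiles that are available at the given state. *)
Record cgm := CGM {
  nagt : nat;
  state : Type;
  prp : Type;
  act : Type;
  state_inh : inhabited state;
  prp_inh : inhabited prp;
  act_inh : inhabited act;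
  avail : 'I_nagt -> state -> act -> Prop;
  avail_nonempty : forall i q, exists a, avail i q a;
  outcome : forall q, (forall i, {a : act | avail i q a}) -> state;
  val_prp : prp -> state -> Prop
}.

Notation agent M := 'I_(nagt M).
Notation coalition M := {set 'I_(nagt M)}.

Definition profile (M : cgm) (q : state M) : Type :=
  forall i : agent M, {a : act M | avail i q a}.

Definition action (M : cgm) (A : coalition M) (q : state M) : Type :=
  forall i : agent M, i \in A -> {a : act M | avail i q a}.

Lemma notin_setC (T : finType) (A : {set T}) (x : T) : x \notin A -> x \in ~: A.
Proof. by rewrite in_setC. Qed.

Definition combine (M : cgm) (A : coalition M) (q : state M)
    (b : action A q) (c : action (~: A) q) : profile q :=
  fun i => match boolP (i \in A) with
           | AltTrue h => b i h
           | AltFalse h => c i (notin_setC h)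
           end.

Inductive atl (k : nat) (Pi : Type) : Type :=
| Atom of Pi
| Neg of atl k Pi
| Or of atl k Pi & atl k Pi
| Next of {set 'I_k} & atl k Pi
| Until of {set 'I_k} & atl k Pi & atl k Pi
| Release of {set 'I_k} & atl k Pi & atl k Pi.

Notation formula M := (atl (nagt M) (prp M)).

Definition strategy (M : cgm) (a : agent M) : Type :=
  {s : state M -> act M | forall q, avail a q (s q)}.

Definition cstrategy (M : cgm) (A : coalition M) : Type :=
  forall a : agent M, a \in A -> strategy a.

Definition paths (M : cgm) (A : coalition M) (q : state M) (S : cstrategy A)
    (L : nat -> state M) : Prop :=
  L 0 = q /\
  forall n, exists2 alpha : profile (L n),
    forall a (aA : a \in A), sval (alpha a) = sval (S a aA) (L n)
    & L n.+1 = outcome alpha.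

Fixpoint sat (M : cgm) (phi : formula M) (q : state M) {struct phi} : Prop :=
  match phi with
  | Atom p => val_prp p q
  | Neg psi => ~ sat psi q
  | Or psi theta => sat psi q \/ sat theta q
  | Next A psi =>
      exists S : cstrategy A, forall L, paths q S L -> sat psi (L 1)
  | Until A psi theta =>
      exists S : cstrategy A, forall L, paths q S L ->
        exists i, sat theta (L i) /\ forall j, j < i -> sat psi (L j)
  | Release A psi theta =>
      exists S : cstrategy A, forall L, paths q S L ->
        forall i, sat theta (L i) \/ exists j, j < i /\ sat psi (L j)
  end.

Inductive player := Eloise | Abelard.

Definition opponent (P : player) : player :=
  match P with Eloise => Abelard | Abelard => Eloise end.

Definition same_player (P Q : player) : bool :=
  match P, Q with
  | Eloise, Eloise | Abelard, Abelard => true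
  | _, _ => false
  end.

(* What player W contributes to step(V, A, q). *)
Definition step_move (M : cgm) (W V : player) (A : coalition M) (q : state M) :
    Type :=
  if same_player W V then action A q else action A q -> action (~: A) q.

(* q' can result from step(V, A, q) when W plays m and the opponent of W plays
   arbitrarily. *)
Definition step_result (M : cgm) (W V : player) (A : coalition M) (q : state M) :
    step_move W V A q -> state M -> Prop :=
  match same_player W V as b return
    (if b then action A q else action A q -> action (~: A) q) ->
    state M -> Prop
  with
  | true => fun b q' => exists c, q' = outcome (combine b c)
  | false => fun r q' => exists b, q' = outcome (combine b (r b))
  end.

(* The embedded game g(V, C, A, q0, psi_C, psi_C'), where C' is the opponent of
   the controller C. *)
Record embgame (M : cgm) := EmbGame {
  verifier : player;
  controller : player;
  coal : coalition M;
  initial : state M;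
  exitC : formula M;
  exitC' : formula M
}.

Inductive config (M : cgm) :=
| Pos of player & state M & formula M
| Emb of embgame M & state M.

(* Strategies of player W.  Until and release positions correspond one-to-one to
   the embedded games played there, so embedded-game strategies are indexed by
   the latter; None means "end the game".  Components are total in the formulae:
   plays from a formula only ever reach its subformulae, so the values elsewhere
   are irrelevant. *)
Record gstrategy (M : cgm) (W : player) := GStrategy {
  choose_left : state M -> formula M -> formula M -> bool;
  play_next : forall (V : player) (q : state M) (A : coalition M)
                     (psi : formula M), step_move W V A q;
  play_emb : forall (g : embgame M) (q : state M),
               option (step_move W (verifier g) (coal g) q)
}.

(* One move of the evaluation game in which W follows sigma and the opponent
   plays arbitrarily.  In an embedded game the controller is the first to be
   offered to end it, then the controller's opponent; only if both decline is a
   one step game played. *)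
Inductive move (M : cgm) (W : player) (sigma : gstrategy M W) :
    config M -> config M -> Prop :=
| move_neg P q psi :
    move sigma (Pos P q (Neg psi)) (Pos (opponent P) q psi)
| move_or_own q psi theta :
    move sigma (Pos W q (Or psi theta))
               (Pos W q (if choose_left sigma q psi theta then psi else theta))
| move_or_opp_left q psi theta :
    move sigma (Pos (opponent W) q (Or psi theta)) (Pos (opponent W) q psi)
| move_or_opp_right q psi theta :
    move sigma (Pos (opponent W) q (Or psi theta)) (Pos (opponent W) q theta)
| move_next P q A psi q' :
    step_result (play_next sigma P q A psi) q' ->
    move sigma (Pos P q (Next A psi)) (Pos P q' psi)
| move_until P q A psi theta :
    move sigma (Pos P q (Until A psi theta))
               (Emb (EmbGame P P A q theta psi) q)
| move_release P q A psi theta :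
    move sigma (Pos P q (Release A psi theta))
               (Emb (EmbGame P (opponent P) A q theta psi) q)
| move_exitC_own g q :
    controller g = W -> play_emb sigma g q = None ->
    move sigma (Emb g q) (Pos (verifier g) q (exitC g))
| move_exitC_opp g q :
    controller g = opponent W ->
    move sigma (Emb g q) (Pos (verifier g) q (exitC g))
| move_exitC'_own g q :
    controller g = opponent W -> play_emb sigma g q = None ->
    move sigma (Emb g q) (Pos (verifier g) q (exitC' g))
| move_exitC'_opp g q :
    controller g = W -> play_emb sigma g q <> None ->
    move sigma (Emb g q) (Pos (verifier g) q (exitC' g))
| move_step g q m q' :
    play_emb sigma g q = Some m -> step_result m q' ->
    move sigma (Emb g q) (Emb g q').

(* FinPlay n rho is the play rho 0, ..., rho n. *)
Inductive play (M : cgm) :=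
| FinPlay of nat & (nat -> config M)
| InfPlay of (nat -> config M).

(* Complete plays from c consistent with sigma; a finite play is complete when it
   has reached an atomic formula. *)
Definition consistent_play (M : cgm) (W : player) (sigma : gstrategy M W)
    (c : config M) (pi : play M) : Prop :=
  match pi with
  | FinPlay n rho =>
      [/\ rho 0 = c,
          forall i, i < n -> move sigma (rho i) (rho i.+1)
        & exists P q p, rho n = Pos P q (Atom _ p)]
  | InfPlay rho =>
      rho 0 = c /\ forall i, move sigma (rho i) (rho i.+1)
  end.

(* An infinite play eventually stays in one embedded game, whose controller
   loses. *)
Definition wins (M : cgm) (W : player) (pi : play M) : Prop :=
  match pi with
  | FinPlay n rho =>
      exists P q p, rho n = Pos P q (Atom _ p) /\
        (P = W /\ val_prp p q \/ P = opponent W /\ ~ val_prp p q)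
  | InfPlay rho =>
      exists (n : nat) (g : embgame M),
        (forall i, n <= i -> exists q, rho i = Emb g q) /\
        controller g = opponent W
  end.

Definition winning_strategy (M : cgm) (W : player) (q : state M)
    (phi : formula M) (sigma : gstrategy M W) : Prop :=
  forall pi, consistent_play sigma (Pos Eloise q phi) pi -> wins W pi.

Definition gsat_u (M : cgm) (phi : formula M) (q : state M) : Prop :=
  exists sigma : gstrategy M Eloise, winning_strategy q phi sigma.

(* Main.v *)
Require Import Defs.
From mathcomp Require Import all_boot.
From mathcomp Require Import boolp wochoice.

Set Implicit Arguments.
Unset Strict Implicit.
Unset Printing Implicit Defensive.

(** Both semantics of until and release are compared with attractors of one step
    games: [<<A>> psi U theta] holds where the verifier can force [theta] through
    [psi]-states, and [<<A>> psi R theta] fails where the falsifier can force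
    [~ theta] through [~ psi]-states.  The attractor is an inductive predicate,
    so all arguments about finite duration become inductions; what it leaves open
    is whether a single positional strategy wins from every state of the
    attractor.  This is obtained by well-ordering the positional strategies and
    letting each state use the least strategy that wins from it: along a play
    this least strategy can only decrease.  Positions are then matched with truth
    values by induction on formulae, in both directions: the strategy made of the
    attractor moves (and, for the opponent of the controller, of moves that avoid
    the controller's attractor) wins from all positions whose truth value is the
    right one, and any winning strategy only passes through such positions. *)

(** * Attractors and positional strategies *)

Section Attractor.
Variables (X : Type) (Mv : X -> Type) (res : forall x, Mv x -> X -> Prop).
Variables (T G : X -> Prop).

Inductive attr (x : X) : Prop :=
| attr_goal : T x -> attr x
| attr_step (m : Mv x) :
    G x -> (forall y, res m y -> attr y) -> attr x.

Inductive pos_wins (s : forall x, Mv x) (x : X) : Prop :=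
| pos_wins_goal : T x -> pos_wins s x
| pos_wins_step :
    G x -> (forall y, res (s x) y -> pos_wins s y) -> pos_wins s x.

Lemma uniform_pos_wins (d : forall x, Mv x) :
  exists s, forall s' x, pos_wins s' x -> pos_wins s x.
Proof.
pose U : eqType := {classic (forall x, Mv x)}.
have [R Rwo] := well_ordering_principle U.
have least x : exists s : U, (exists s' : U, pos_wins s' x) ->
    minimum_of R (fun s' : U => `[< pos_wins s' x >]) s.
  have [[s' ws']|no] := pselect (exists s' : U, pos_wins s' x); last first.
    by exists d.
  have [|s [smin _]] := Rwo (fun s' : U => `[< pos_wins s' x >]).
    by exists s'; apply/asboolP.
  by exists s.
have [l lP] := choice least.
pose s : forall x, Mv x := fun x => l x x.
exists s => s0 x0 w0; apply: contrapT => nw0.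
(* The least [s1] that wins from some state where [s] does not is refuted by following its win
   inductively. *)
pose bad (s' : U) := `[< exists2 x, pos_wins s' x & ~ pos_wins s x >].
have [|s1 [[/asboolP[x1 w1 nw1] s1min] _]] := Rwo bad.
  by exists s0; apply/asboolP; exists x0.
apply: nw1; elim: w1 => {x1}[x Tx|x Gx wx IH].
  exact: pos_wins_goal.
have w1x : pos_wins s1 x by apply: pos_wins_step.
apply: contrapT => nwx.
have [lw lmin] := lP x (ex_intro _ s1 w1x).
move: lw => /asboolP lw.
(* Both are the minimum of one set, the bad strategies winning from [x]: [s1] is least among all bad
   ones, [l x] among all that win from [x]. *)
have els : s1 = l x :> U.
  have [|z [_ zu]] := Rwo (fun t => `[< pos_wins t x >] && bad t).
    exists s1; apply/andP; split; apply/asboolP => //; by exists x.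
  rewrite -(zu s1) ?(zu (l x)) //.
    split; first by apply/andP; split; apply/asboolP => //; exists x.
    by move=> t /andP[tw _]; apply: lmin.
  split; first by apply/andP; split; apply/asboolP => //; exists x.
  by move=> t /andP[_ tb]; apply: s1min.
apply: nwx; apply: pos_wins_step => // y.
by rewrite /s -els => /IH.
Qed.

(** Induction on the attractor: if [s] wins from all results of [m], then [s] altered to play [m] at
    [x] wins from [x], and by uniformity so does [s] itself. *)
Lemma attr_positional (d : forall x, Mv x) :
  exists s, forall x, attr x -> pos_wins s x.
Proof.
have [s sP] := uniform_pos_wins d; exists s => x; elim=> {x}[x Tx|x m Gx _ IH].
  exact: pos_wins_goal.
pose s' : forall y, Mv y := fun y =>
  if pselect (x = y) is left e then eq_rect x Mv m y e else s y.
have s'x : s' x = m.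
  rewrite /s'; case: pselect => // e; by rewrite (Prop_irrelevance e erefl).
apply: contrapT => nwx.
have sub y : pos_wins s y -> pos_wins s' y.
  elim=> {y}[y Ty|y Gy wy IHy]; first exact: pos_wins_goal.
  (* As [s] is assumed not to win from [x], its wins never pass through [x], and altering it there
     does no harm. *)
  have nxy : x <> y by move=> exy; apply: nwx; rewrite exy; apply: pos_wins_step.
  by apply: pos_wins_step => // z; rewrite /s'; case: pselect => // _ /IHy.
apply: nwx; apply: (sP s'); apply: pos_wins_step => // y.
by rewrite s'x => /IH; apply: sub.
Qed.

End Attractor.

Lemma attr_mono (X : Type) (Mv : X -> Type) (res : forall x, Mv x -> X -> Prop)
    (T T' G G' : X -> Prop) :
  (forall x, T x -> T' x) -> (forall x, G x -> G' x) ->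
  forall x, attr res T G x -> attr res T' G' x.
Proof.
move=> TT GG x; elim=> {x}[x /TT|x m /GG Gx _ IH]; first exact: attr_goal.
exact: attr_step Gx IH.
Qed.

(** * One step games *)

Definition default_action (M : cgm) (A : coalition M) (q : state M) :
    action A q :=
  fun i _ => cid (avail_nonempty i q).
Arguments default_action {M} A q i _.

Definition default_step (M : cgm) (W V : player) (A : coalition M)
    (q : state M) : step_move W V A q :=
  match same_player W V as b return
    if b then action A q else action A q -> action (~: A) q
  with
  | true => default_action A q
  | false => fun _ => default_action (~: A) q
  end.
Arguments default_step {M} W V A q.

Section OneStep.
Variable M : cgm.
Implicit Types (A : coalition M) (q : state M).

(** If every tuple has a defeating reply, choice collects these replies into a response function;
    when [W] is the responder, the same dichotomy is applied to [~ P]. *)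
Lemma step_determined (W V : player) A q (P : state M -> Prop) :
  (exists m : step_move W V A q, forall q', step_result m q' -> P q') \/
  (exists m : step_move (opponent W) V A q,
     forall q', step_result m q' -> ~ P q').
Proof.
have act_first Q : (exists b : action A q, forall c, Q (outcome (combine b c))) \/
    exists r : action A q -> action (~: A) q,
      forall b, ~ Q (outcome (combine b (r b))).
  have [|nb] := pselect (exists b : action A q,
                           forall c, Q (outcome (combine b c))); first by left.
  have /choice[r rP] : forall b, exists c : action (~: A) q,
      ~ Q (outcome (combine b c)).
    move=> b; apply: contrapT => nc; apply: nb; exists b => c.
    by apply: contrapT => np; apply: nc; exists c.
  by right; exists r.
have resp_first : (exists r : action A q -> action (~: A) q,
      forall b, P (outcome (combine b (r b)))) \/
    exists b : action A q, forall c, ~ P (outcome (combine b c)).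
  have [|[r rP]] := act_first (fun x => ~ P x); first by right.
  by left; exists r => b; apply: contrapT.
case: W; case: V.
- have [[m mP]|[m mP]] := act_first P;
    [left | right]; by exists m => q' [? ->].
- have [[m mP]|[m mP]] := resp_first; [left | right]; by exists m => q' [? ->].
- have [[m mP]|[m mP]] := resp_first; [left | right]; by exists m => q' [? ->].
- have [[m mP]|[m mP]] := act_first P;
    [left | right]; by exists m => q' [? ->].
Qed.

Lemma step_meet (W V : player) A q (m : step_move W V A q)
    (m' : step_move (opponent W) V A q) :
  exists2 q', step_result m q' & step_result m' q'.
Proof.
case: W V m m' => -[] m m'.
- by exists (outcome (combine m (m' m))); eexists.
- by exists (outcome (combine m' (m m'))); eexists.
- by exists (outcome (combine m' (m m'))); eexists.
- by exists (outcome (combine m (m' m))); eexists.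
Qed.

(** The guarantee is conditional so that a move exists at every state; this yields total
    strategies. *)
Lemma best_step (W V : player) A q (P : state M -> Prop) :
  {m : step_move W V A q |
    (exists m' : step_move W V A q, forall q', step_result m' q' -> P q') ->
    forall q', step_result m q' -> P q'}.
Proof.
case: (pselect (exists m' : step_move W V A q,
                  forall q', step_result m' q' -> P q')) => [/cid[m mP]|no].
  by exists m.
by exists (default_step W V A q).
Qed.

Definition forced (W V : player) A (T G : state M -> Prop) : state M -> Prop :=
  attr (Mv := step_move W V A) (fun q m q' => step_result m q') T G.

End OneStep.

(** * Fixpoint characterization of until and release *)

Lemma sval_inj (T : Type) (P : T -> Prop) : injective (@sval T P).
Proof. by move=> [x Px] [y Py] /= exy; apply: eq_exist. Qed.

Section Fixpoints.
Variable M : cgm.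
Implicit Types (A : coalition M) (q : state M) (psi theta : formula M).

Definition cstrategy_action A (S : cstrategy A) q : action A q :=
  fun i iA => exist _ (sval (S i iA) q) (svalP (S i iA) q).

Definition cstrategy_of A (s : forall q, action A q) : cstrategy A :=
  fun i iA => exist (fun f : state M -> act M => forall q, avail i q (f q))
                    (fun q => sval (s q i iA)) (fun q => svalP (s q i iA)).

Lemma cstrategy_ofK A (s : forall q, action A q) q :
  cstrategy_action (cstrategy_of s) q = s q.
Proof.
apply: functional_extensionality_dep => i.
apply: functional_extensionality_dep => iA.
exact: sval_inj.
Qed.

(* Elimination of [boolP (i \in A)] must not abstract [i \in A] in the types of
   [b] and [c]. *)
Lemma combine_case A q (b : action A q) (c : action (~: A) q) i
    (Q : {a | avail i q a} -> Prop) :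
  (forall iA : i \in A, Q (b i iA)) ->
  (forall iA : i \notin A, Q (c i (notin_setC iA))) -> Q (combine b c i).
Proof.
rewrite /combine => Qb Qc; generalize (boolP (i \in A)).
set t := (X in alt_spec _ _ X); generalize t => t' a.
by case: a.
Qed.

Lemma combine_in A q (b : action A q) (c : action (~: A) q) i (iA : i \in A) :
  combine b c i = b i iA.
Proof.
apply: (combine_case (Q := fun x => x = b i iA)) => [iA'|/negP//].
by rewrite (Prop_irrelevance iA iA').
Qed.

Lemma combineK A q (b : action A q) (al : profile q) :
  (forall i (iA : i \in A), al i = b i iA) -> combine b (fun i _ => al i) = al.
Proof.
move=> alb; apply: functional_extensionality_dep => i.
by apply: (combine_case (Q := fun x => x = al i)).
Qed.

Lemma pathsP A q (S : cstrategy A) L :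
  paths q S L <-> L 0 = q /\
    forall n, exists c, L n.+1 = outcome (combine (cstrategy_action S (L n)) c).
Proof.
split=> -[L0 Ln]; split=> // n.
  have [al alS ->] := Ln n; exists (fun i _ => al i).
  by rewrite combineK // => i iA; apply: sval_inj; rewrite alS.
have [c ->] := Ln n; eexists; last reflexivity.
by move=> i iA; rewrite (combine_in _ _ iA).
Qed.

Lemma paths_cons A q (S : cstrategy A) L c :
  paths (outcome (combine (cstrategy_action S q) c)) S L ->
  paths q S (fun n => if n is n'.+1 then L n' else q).
Proof.
case/pathsP=> L0 Ln; apply/pathsP; split=> // -[|n]; last exact: Ln.
by exists c.
Qed.

(** Choosing one reply per state and iterating gives a path; with trivial [B] this shows that
    [paths q S] is inhabited. *)
Lemma paths_iter A q (S : cstrategy A) (B : state M -> state M -> Prop) :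
  (forall x, exists c, B x (outcome (combine (cstrategy_action S x) c))) ->
  exists2 L, paths q S L & forall n, B (L n) (L n.+1).
Proof.
move=> Bx.
have /choice[f fP] : forall x, exists y,
    (exists c, y = outcome (combine (cstrategy_action S x) c)) /\ B x y.
  move=> x; have [c cB] := Bx x.
  by exists (outcome (combine (cstrategy_action S x) c)); split=> //; exists c.
exists (fun n => iter n f q); last by move=> n; apply: (fP _).2.
by apply/pathsP; split=> // n; apply: (fP _).1.
Qed.

Lemma sat_nextP A psi q :
  sat (Next A psi) q <->
  exists b : step_move Eloise Eloise A q,
    forall q', step_result b q' -> sat psi q'.
Proof.
split=> /= [[S SP]|ex].
  exists (cstrategy_action S q) => q' [c ->].
  have [|L Lp _] :=
    @paths_iter A (outcome (combine (cstrategy_action S q) c)) S (fun _ _ => True).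
    by move=> x; exists (default_action _ _).
  by have [<- _] := Lp; apply: SP (paths_cons Lp).
pose s x := sval (best_step Eloise Eloise A x (sat psi)).
exists (cstrategy_of s) => L /pathsP[L0 Ln].
have := Ln 0; rewrite L0 cstrategy_ofK => -[c L1].
by apply: (svalP (best_step Eloise Eloise A q (sat psi))) => //; exists c.
Qed.

Lemma sat_untilP A psi theta q :
  sat (Until A psi theta) q <->
  forced Eloise Eloise A (sat theta) (sat psi) q.
Proof.
split=> /=.
  case=> S SP; apply: contrapT => nq.
  pose Z := forced Eloise Eloise A (sat theta) (sat psi).
  (* If all replies led into [Z], the move of [S] would put the [psi]-state [x] itself in [Z]; so
     the path can avoid [Z] while [psi] holds. *)
  have [|L Lp LB] := @paths_iter A q S (fun x y => ~ Z x -> sat psi x -> ~ Z y).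
    move=> x; apply: contrapT => nc.
    have [] := nc; exists (default_action _ _) => nZ px _; apply: nZ.
    apply: (@attr_step _ _ _ _ _ _ (cstrategy_action S x)) => // y [c ->].
    by apply: contrapT => nZ; apply: nc; exists c.
  have [i [ti pj]] := SP L Lp; have [L0 _] := Lp.
  have nZ j : j <= i -> ~ Z (L j).
    elim: j => [_|j IH ji]; first by rewrite L0.
    by apply: LB; [apply/IH/ltnW | apply: pj].
  by apply: (nZ i) => //; apply: attr_goal.
have [s sP] := attr_positional (Mv := step_move Eloise Eloise A)
  (fun q m q' => step_result m q') (sat theta) (sat psi)
  (default_step Eloise Eloise A).
move=> /sP wq; exists (cstrategy_of s).
elim: wq => {q}[q tq|q pq _ IH] L /pathsP[L0 Ln]; first by exists 0; rewrite L0.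
have := Ln 0; rewrite L0 cstrategy_ofK => -[c L1].
have [||i [ti pj]] := IH (L 1) _ (fun n => L n.+1).
- by exists c.
- by apply/pathsP; split=> // n; apply: Ln.
by exists i.+1; split=> // -[|j] ji; [rewrite L0 | apply: pj].
Qed.

(** Only whether the two players coincide matters: [Eloise] stands for the falsifier, who answers
    the coalition, and [Abelard] for the verifier. *)
Lemma sat_releaseP A psi theta q :
  sat (Release A psi theta) q <->
  ~ forced Eloise Abelard A (fun x => ~ sat theta x) (fun x => ~ sat psi x) q.
Proof.
pose Z := forced Eloise Abelard A (fun x => ~ sat theta x) (fun x => ~ sat psi x).
split=> /=.
  case=> S SP fq; elim: fq SP => {q}[q ntq|q r npq _ IH] SP.
    have [|L Lp _] := @paths_iter A q S (fun _ _ => True).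
      by move=> x; exists (default_action _ _).
    by have [L0 _] := Lp; have [|[j []]//] := SP L Lp 0; rewrite L0.
  apply: (IH (outcome (combine (cstrategy_action S q) (r (cstrategy_action S q))))).
    by eexists.
  (* Prefixing [q] shifts indices by one, and index 0 cannot release [theta] because [psi] fails at
     [q]. *)
  move=> L Lp i; have [|[[|j] [ji pj]]] := SP _ (paths_cons Lp) i.+1.
  - by left.
  - by case: npq.
  - by right; exists j.
move=> nq.
pose s x := sval (best_step Eloise Eloise A x (fun y => ~ Z y)).
exists (cstrategy_of s) => L /pathsP[L0 Ln].
(* Outside [Z], either [psi] holds and releases [theta], or by determinacy the coalition can stay
   outside [Z]. *)
have safe i : ~ Z (L i) \/ exists j, j < i /\ sat psi (L j).
  elim: i => [|i [nZ|[j [ji pj]]]]; first by left; rewrite L0.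
    have [pi|npi] := pselect (sat psi (L i)); first by right; exists i.
    left; have [c Li] := Ln i; rewrite cstrategy_ofK in Li.
    apply: (svalP (best_step Eloise Eloise A (L i) (fun y => ~ Z y))); last by exists c.
    have [[r rP]|//] := step_determined Eloise Abelard A (L i) Z.
    by case: nZ; apply: (@attr_step _ _ _ _ _ _ r).
  by right; exists j; split=> //; apply: ltnW.
move=> i; have [nZ|] := safe i; last by right.
by left; apply: contrapT => nt; apply: nZ; apply: attr_goal.
Qed.

End Fixpoints.

(** * Plays *)

Section Plays.
Variables (M : cgm) (sigma : gstrategy M Eloise).
Implicit Types (c : config M) (rho : nat -> config M).

Definition wins_from c : Prop :=
  forall pi, consistent_play sigma c pi -> wins Eloise pi.

Definition is_atomic c : Prop := exists P q p, c = Pos P q (Atom _ p).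

Lemma wins_shift k rho :
  wins Eloise (InfPlay (fun i => rho (k + i))) -> wins Eloise (InfPlay rho).
Proof.
case=> n [g [gE gC]]; exists (k + n), g; split=> // i ki.
have [|q qE] := gE (i - k); first by rewrite leq_subRL // (leq_trans _ ki) ?leq_addr.
by exists q; rewrite -qE subnKC // (leq_trans _ ki) ?leq_addr.
Qed.

Lemma wins_from_tail k rho : (forall i, move sigma (rho i) (rho i.+1)) ->
  wins_from (rho k) -> wins Eloise (InfPlay rho).
Proof.
move=> rhoM w; apply: (@wins_shift k); apply: w.
by split=> [|i]; rewrite ?addn0 ?addnS.
Qed.

Lemma wins_from_move c c' : move sigma c c' -> wins_from c -> wins_from c'.
Proof.
move=> mv w [n rho [rho0 rhoM rhoA]|rho [rho0 rhoM]];
  pose rho' n := if n is n'.+1 then rho n' else c.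
  apply: (w (FinPlay n.+1 rho')); split=> // -[_|i]; last exact: rhoM.
  by rewrite /= rho0.
have [|n [g [gE gC]]] := w (InfPlay rho').
  by split=> // -[|i]; [rewrite /= rho0 | apply: rhoM].
by exists n, g; split=> // i ni; apply: (gE i.+1); apply: leqW.
Qed.

(** Atomic positions are excluded because plays end there: without moves, the premise would hold
    vacuously. *)
Lemma wins_from_all_moves c : ~ is_atomic c ->
  (forall c', move sigma c c' -> wins_from c') -> wins_from c.
Proof.
move=> natom w [[|n] rho [rho0 rhoM rhoA]|rho [rho0 rhoM]].
- by case: natom; rewrite -rho0.
- have w1 : wins_from (rho 1) by apply: w; rewrite -rho0; apply: rhoM.
  by apply: (w1 (FinPlay n (fun i => rho i.+1))); split=> // i; apply: (rhoM i.+1).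
- by apply: (wins_from_tail (k := 1)) => //; apply: w; rewrite -rho0.
Qed.

(** A play either reaches a winning configuration or stays in the embedded game forever, and then
    the controller Abelard loses. *)
Lemma wins_from_invariant g (I : state M -> Prop) :
  controller g = Abelard ->
  (forall q c, I q -> move sigma (Emb g q) c ->
     (exists2 q', I q' & c = Emb g q') \/ wins_from c) ->
  forall q, I q -> wins_from (Emb g q).
Proof.
move=> gA stay q Iq [n rho|rho [rho0 rhoM]].
  elim: n q Iq rho => [|n IH] q Iq rho [rho0 rhoM rhoA].
    by case: rhoA => P [q' [p]]; rewrite rho0.
  have tail : consistent_play sigma (rho 1) (FinPlay n (fun i => rho i.+1)).
    by split=> // i; apply: (rhoM i.+1).
  have [|[q' Iq' e]|w] := stay q (rho 1) Iq; first by rewrite -rho0; apply: rhoM.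
    by rewrite e in tail; apply: (IH q' Iq' _ tail).
  exact: w tail.
apply: contrapT => lose.
have inside i : exists2 q', I q' & rho i = Emb g q'.
  elim: i => [|i [q' Iq' e]]; first by exists q.
  have [|//|w] := stay q' (rho i.+1) Iq'; first by rewrite -e.
  by case: lose; apply: wins_from_tail w.
by apply: lose; exists 0, g; split=> // i _; have [q' _ ->] := inside i; exists q'.
Qed.

End Plays.

(** * Truth values of positions *)

Section Truth.
Variable M : cgm.
Implicit Types (q : state M) (phi : formula M) (g : embgame M).

Definition good (P : player) phi q : Prop :=
  match P with Eloise => sat phi q | Abelard => ~ sat phi q end.

(** The controller's opponent may exit at any state, so the controller needs the other exit to be
    favourable until its own is. *)
Definition good_emb g q : Prop :=
  match controller g with
  | Eloise => forced Eloise (verifier g) (coal g)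
                (good (verifier g) (exitC g)) (good (verifier g) (exitC' g)) q
  | Abelard => ~ forced Abelard (verifier g) (coal g)
                (fun x => ~ good (verifier g) (exitC g) x)
                (fun x => ~ good (verifier g) (exitC' g) x) q
  end.

(** For the verifier Abelard, determinacy supplies Eloise's response function, and [step_meet] shows
    that it rules out a winning tuple. *)
Lemma good_next P A psi q :
  good P (Next A psi) q <->
  exists m : step_move Eloise P A q,
    forall q', step_result m q' -> good P psi q'.
Proof.
case: P; rewrite /good; first exact: sat_nextP.
rewrite (sat_nextP A psi q); split=> [nb|[r rP] [b bP]].
  by have [] := step_determined Abelard Abelard A q (sat psi).
have [q' /rP nq' /bP sq'] := @step_meet M Eloise Abelard A q r b.
exact: nq'.
Qed.

Lemma good_until P A psi theta q0 q :
  good P (Until A psi theta) q <-> good_emb (EmbGame P P A q0 theta psi) q.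
Proof.
case: P; rewrite /good_emb /good; cbn -[sat]; first exact: sat_untilP.
rewrite (sat_untilP A psi theta q); split; apply: contra_not.
  by apply: attr_mono => x; apply: contrapT.
by apply: attr_mono => x sx nx.
Qed.

Lemma good_release P A psi theta q0 q :
  good P (Release A psi theta) q <->
  good_emb (EmbGame P (opponent P) A q0 theta psi) q.
Proof.
(* [forced Eloise Abelard] and [forced Abelard Eloise] are convertible, so one characterization
   serves both verifiers. *)
case: P; rewrite /good_emb /good; cbn -[sat]; first exact: sat_releaseP.
rewrite (sat_releaseP A psi theta q); split; first exact: contrapT.
by move=> z nz.
Qed.

End Truth.

(** * The canonical strategy *)

Section Canonical.
Variable M : cgm.

Definition attractor_strategy (g : embgame M) :=
  cid (attr_positional (Mv := step_move Eloise (verifier g) (coal g))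
    (fun q m q' => step_result m q')
    (good (verifier g) (exitC g)) (good (verifier g) (exitC' g))
    (default_step Eloise (verifier g) (coal g))).

Definition canonical : gstrategy M Eloise := {|
  choose_left q psi theta := `[< sat psi q >];
  play_next V q A psi := sval (best_step Eloise V A q (good V psi));
  play_emb g q :=
    match controller g with
    | Eloise => if `[< good (verifier g) (exitC g) q >] then None
                else Some (sval (attractor_strategy g) q)
    | Abelard => if `[< good (verifier g) (exitC' g) q >] then None
                 else Some (sval (best_step Eloise (verifier g) (coal g) q
                                    (good_emb g)))
    end |}.

Lemma canonical_emb_wins (g : embgame M) :
  (forall q, good (verifier g) (exitC g) q ->
     wins_from canonical (Pos (verifier g) q (exitC g))) ->
  (forall q, good (verifier g) (exitC' g) q ->
     wins_from canonical (Pos (verifier g) q (exitC' g))) ->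
  forall q, good_emb g q -> wins_from canonical (Emb g q).
Proof.
move=> wC wC'; case gC : (controller g).
  move=> q; rewrite /good_emb gC => /(svalP (attractor_strategy g)).
  elim=> {q}[q Tq|q Gq _ IH]; apply: wins_from_all_moves; try by case=> ? [? []].
    move=> c mv; inversion mv as
      [| | | | | | |g' q' _ pE|g' q' gO|g' q' gO _|g' q' _ pE|g' q' m q'' pE mr];
      subst; try (by rewrite gC in gO); move: pE; rewrite /= gC.
    + by move=> _; apply: wC.
    + by rewrite asboolT.
    + by rewrite asboolT.
  move=> c mv; inversion mv as
    [| | | | | | |g' q' _ pE|g' q' gO|g' q' gO _|g' q' _ pE|g' q' m q'' pE mr];
    subst; try (by rewrite gC in gO); move: pE; rewrite /= gC.
  + by case: asboolP => // Tq _; apply: wC.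
  + by move=> _; apply: wC'.
  + by case: asboolP => // _ [em]; apply: IH; rewrite em.
apply: wins_from_invariant => // q c Iq mv; inversion mv as
  [| | | | | | |g' q' gO _|g' q' gO|g' q' gO pE|g' q' gO _|g' q' m q'' pE mr];
  subst; try (by rewrite gC in gO).
- right; apply: wC; apply: contrapT => nT; move: Iq; rewrite /good_emb gC; apply.
  exact: attr_goal.
- by right; apply: wC'; move: pE; rewrite /= gC; case: asboolP.
- left; exists q'' => //; move: pE; rewrite /= gC; case: asboolP => // nG [em].
  move: q'' mr {mv}; rewrite -em.
  apply: (svalP (best_step Eloise (verifier g) (coal g) q (good_emb g))).
  move: Iq; rewrite {1}/good_emb gC => nZ.
  (* As [exitC'] is not good at [q], a move of Abelard into his attractor would put [q] in it; so
     Eloise can stay outside. *)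
  have [[m' mP]|[m' mP]] := step_determined Eloise (verifier g) (coal g) q
    (good_emb g); first by exists m'.
  case: nZ; apply: (@attr_step _ _ _ _ _ _ m') => // y /mP.
  by rewrite /good_emb gC => /contrapT.
Qed.

Lemma canonical_wins (phi : formula M) (P : player) (q : state M) :
  good P phi q -> wins_from canonical (Pos P q phi).
Proof.
elim: phi P q => [p|psi IH|psi IH1 theta IH2|A psi IH|A psi IH1 theta IH2
  |A psi IH1 theta IH2] P q gq.
- move=> [[|n] rho [rho0 rhoM rhoA]|rho [rho0 rhoM]].
  + exists P, q, p; split=> //.
    by case: P gq {rho0} => gq; [left | right].
  + by have := rhoM 0 isT; rewrite rho0 => mv; inversion mv.
  + by have := rhoM 0; rewrite rho0 => mv; inversion mv.
- apply: wins_from_all_moves; first by case=> ? [? []].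
  move=> c mv; inversion mv; subst; apply: IH.
  by case: P gq {mv} => //= /contrapT.
- apply: wins_from_all_moves; first by case=> ? [? []].
  move=> c mv; inversion mv; subst; rewrite /= in gq.
  + by rewrite /=; case: asboolP => sq; [apply: IH1 | apply: IH2; case: gq].
  + by apply: IH1 => sq; apply: gq; left.
  + by apply: IH2 => sq; apply: gq; right.
- apply: wins_from_all_moves; first by case=> ? [? []].
  move=> c mv; inversion mv; subst; apply: IH.
  apply: (svalP (best_step Eloise P A q (good P psi))) => //.
  exact/good_next.
- apply: wins_from_all_moves; first by case=> ? [? []].
  move=> c mv; inversion mv; subst.
  apply: canonical_emb_wins; [exact: IH2 | exact: IH1 |].
  exact/good_until.
- apply: wins_from_all_moves; first by case=> ? [? []].
  move=> c mv; inversion mv; subst.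
  apply: canonical_emb_wins; [exact: IH2 | exact: IH1 |].
  exact/good_release.
Qed.

End Canonical.

(** * Winning strategies only pass through true positions *)

Section Soundness.
Variables (M : cgm) (sigma : gstrategy M Eloise).

(** If Abelard controls, his attractor moves against [sigma] would lead to a bad exit. If Eloise
    controls, outside her attractor [sigma] could be kept in the game forever, which she loses. *)
Lemma wins_from_emb_good (g : embgame M) :
  (forall q, wins_from sigma (Pos (verifier g) q (exitC g)) ->
     good (verifier g) (exitC g) q) ->
  (forall q, wins_from sigma (Pos (verifier g) q (exitC' g)) ->
     good (verifier g) (exitC' g) q) ->
  forall q, wins_from sigma (Emb g q) -> good_emb g q.
Proof.
move=> wC wC' q w; rewrite /good_emb; case gC : (controller g); last first.
  move=> fq; elim: fq w => {q}[q nT|q m nG _ IH] w.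
    by apply: nT; apply: wC; apply: wins_from_move w; apply: move_exitC_opp.
  case pE : (play_emb sigma g q) => [m'|].
    have [y m'y my] := @step_meet M Eloise _ _ _ m' m.
    by apply: (IH y my); apply: wins_from_move w; apply: move_step m'y.
  by apply: nG; apply: wC'; apply: wins_from_move w; apply: move_exitC'_own.
set Z := forced _ _ _ _ _; apply: contrapT => nZq.
(* An exit by [sigma] would be good, and if [sigma] continues, Abelard's option to exit makes
   [exitC'] good; so [x] would be in [Z] unless some step stays outside. *)
have /choice[f fP] : forall x, exists y, ~ Z x /\ wins_from sigma (Emb g x) ->
    [/\ move sigma (Emb g x) (Emb g y), ~ Z y & wins_from sigma (Emb g y)].
  move=> x; apply: contrapT => ny.
  have [nZ wx] : ~ Z x /\ wins_from sigma (Emb g x).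
    by apply: contrapT => nx; apply: ny; exists x.
  case pE : (play_emb sigma g x) => [m|]; last first.
    apply: nZ; apply: attr_goal; apply: wC; apply: wins_from_move wx.
    exact: move_exitC_own.
  apply: nZ; apply: (@attr_step _ _ _ _ _ _ m).
    apply: wC'; apply: wins_from_move wx.
    by apply: move_exitC'_opp => //; rewrite pE.
  move=> y my; apply: contrapT => nZy; apply: ny; exists y => _.
  have mv : move sigma (Emb g x) (Emb g y) by apply: move_step my.
  by split=> //; apply: wins_from_move wx.
have inv n : ~ Z (iter n f q) /\ wins_from sigma (Emb g (iter n f q)).
  by elim: n => [|n /fP[]].
have [|n [g' [gE gO]]] := w (InfPlay (fun n => Emb g (iter n f q))).
  by split=> // n; have [] := fP _ (inv n).
have [q' [eg _]] := gE n (leqnn n).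
by rewrite -eg gC in gO.
Qed.

Lemma wins_from_good (phi : formula M) (P : player) (q : state M) :
  wins_from sigma (Pos P q phi) -> good P phi q.
Proof.
elim: phi P q => [p|psi IH|psi IH1 theta IH2|A psi IH|A psi IH1 theta IH2
  |A psi IH1 theta IH2] P q w.
- have [|P' [q' [p' [[<- <- <-]]]]] := w (FinPlay 0 (fun _ => Pos P q (Atom _ p))).
    by split=> //; exists P, q, p.
  by case=> -[->].
- have /IH : wins_from sigma (Pos (opponent P) q psi).
    by apply: wins_from_move w; apply: move_neg.
  by case: P {w} => //= sq nq.
- case: P w => w.
    have := wins_from_move (move_or_own sigma q psi theta) w.
    by case: choose_left => [/IH1|/IH2]; [left | right].
  have /IH1 n1 := wins_from_move (move_or_opp_left sigma q psi theta) w.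
  have /IH2 n2 := wins_from_move (move_or_opp_right sigma q psi theta) w.
  by case.
- apply/good_next; exists (play_next sigma P q A psi) => q' mq'.
  by apply: IH; apply: wins_from_move w; apply: move_next.
- apply/(good_until _ _ _ _ q).
  apply: wins_from_emb_good; [exact: IH2 | exact: IH1 |].
  by apply: wins_from_move w; apply: move_until.
- apply/(good_release _ _ _ _ q).
  apply: wins_from_emb_good; [exact: IH2 | exact: IH1 |].
  by apply: wins_from_move w; apply: move_release.
Qed.

End Soundness.

Theorem theorem5p1 (M : cgm) (q_in : state M) (phi : formula M) :
  sat phi q_in <-> gsat_u phi q_in.
Proof.
split=> [sq|[sigma w]].
  by exists (canonical M); apply: (canonical_wins (P := Eloise)).
exact: (wins_from_good (P := Eloise) w).
Qed.
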